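(* Let $F\in\mathbb{V}'$, $G\in\mathbb{Q}'$, $\rho>0$, $\lambda>0$ with $\lambda>1/\epsilon_0$. Let $(u_X,p_X)\in\mathbb{V}\times\mathbb{Q}$ be the solution of the discrete saddle point problem, let $(u^n_{X,\lambda,\rho},p^n_{X,\lambda,\rho})$, $n\in\mathbb{N}=\{1,2,\dots\}$, be the iterates of the iterated penalty method, and let $u_{X,1/\lambda}\in\mathbb{V}$ be the solution of the penalized problem $a(u_{X,1/\lambda},v)+\lambda(\mathcal{D}u_{X,1/\lambda},\mathcal{D}v)_Q=F(v)+\lambda G(\mathcal{D}v)$ for all $v\in\mathbb{V}$ (all defined in the context). Define $$\eta_{\lambda,\rho}:=\left|1-\frac{\rho}{\lambda}\right|,\qquad \tau_{X,\lambda,\rho}:=\frac{\rho M_a}{\lambda^2}\min\left\{C_{X,1/\lambda}^{[2]},\frac1{\beta_X}C_{X,1/\lambda}^{[3]}\right\}+\eta_{\lambda,\rho}.$$ Then for all $n\in\mathbb{N}$ $$\|u_X-u^n_{X,\lambda,\rho}\|_V\le\tau_{X,\lambda,\rho}^{n-1}\|u_X-u_{X,1/\lambda}\|_V,$$ $$\|p_X-p^n_{X,\lambda,\rho}\|_Q\le\frac{\rho M_a}{\lambda\beta_X}\sum_{i=1}^n\eta_{\lambda,\rho}^{n-i}\tau_{X,\lambda,\rho}^{i-1}\|u_X-u_{X,1/\lambda}\|_V+\eta_{\lambda,\rho}^n\|p_X\|_Q.$$ Alternatively, with $$C^{[2,3]}_{X,1/\lambda}:=\min\{M_{\mathcal{D}}C_{X,1/\lambda}^{[2]},C_{X,1/\lambda}^{[3]}\},\qquad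 \xi_{X,\lambda,\rho}:=\frac{\rho}{\lambda^2}\min\left\{\frac{M_a}{\beta_X}C_{X,1/\lambda}^{[2,3]},C_{X,1/\lambda}^{[4]}\right\}+\eta_{\lambda,\rho},$$ there holds for all $n\in\mathbb{N}$ $$\|u_X-u^n_{X,\lambda,\rho}\|_V\le\frac1\lambda C_{X,1/\lambda}^{[2,3]}\,\xi_{X,\lambda,\rho}^{n-1}\|p_X\|_Q,\qquad \|p_X-p^n_{X,\lambda,\rho}\|_Q\le\xi_{X,\lambda,\rho}^n\|p_X\|_Q.$$
   Context: Setting. $V,Q$ are real Hilbert spaces with inner products $(\cdot,\cdot)_V,(\cdot,\cdot)_Q$, norms $\|\cdot\|_V,\|\cdot\|_Q$ and duals denoted by a prime. $a:V\times V\to\mathbb{R}$ is a continuous (not necessarily symmetric) bilinear form and $\mathcal{D}:V\to Q$ is a surjective bounded linear operator. With $Z=\ker\mathcal{D}$, there is $\alpha>0$ with $\alpha\le\inf_{u\in Z}\sup_{v\in Z}\frac{a(u,v)}{\|u\|_V\|v\|_V}$ and $\alpha\le\inf_{v\in Z}\sup_{u\in Z}\frac{a(u,v)}{\|u\|_V\|v\|_V}$. Infima and suprema of quotients are over nonzero vectors. $\mathbb{V}\subset V$, $\mathbb{Q}\subset Q$ are finite-dimensional subspaces with $\mathcal{D}\mathbb{V}=\mathbb{Q}$. Let $\mathbb{Z}=\{v\in\mathbb{V}:(\mathcal{D}v,q)_Q=0\ \forall q\in\mathbb{Q}\}$ and assume $$\alpha_X:=\inf_{u\in\mathbb{Z}}\sup_{v\in\mathbb{Z}}\frac{a(u,v)}{\|u\|_V\|v\|_V}=\inf_{v\in\mathbb{Z}}\sup_{u\in\mathbb{Z}}\frac{a(u,v)}{\|u\|_V\|v\|_V}>0,\qquad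 \beta_X:=\inf_{q\in\mathbb{Q}}\sup_{v\in\mathbb{V}}\frac{(\mathcal{D}v,q)_Q}{\|v\|_V\|q\|_Q}>0.$$ Let $M_a:=\sup_{u,v\in V}\frac{a(u,v)}{\|u\|_V\|v\|_V}$, $M_{\mathcal{D}}:=\sup_{v\in V}\frac{\|\mathcal{D}v\|_Q}{\|v\|_V}$. $\mathcal{R}_{\mathbb{Q}}:\mathbb{Q}\to\mathbb{Q}'$ is the Riesz map, $(\mathcal{R}_{\mathbb{Q}}p)(q)=(p,q)_Q$. Discrete saddle point problem: find $u_X\in\mathbb{V}$, $p_X\in\mathbb{Q}$ with $a(u_X,v)+(\mathcal{D}v,p_X)_Q=F(v)$ for all $v\in\mathbb{V}$ and $(\mathcal{D}u_X,q)_Q=G(q)$ for all $q\in\mathbb{Q}$ (it is uniquely solvable). Iterated penalty method: $p^0_{X,\lambda,\rho}:=0$ and for $n\ge1$, $u^n_{X,\lambda,\rho}\in\mathbb{V}$, $p^n_{X,\lambda,\rho}\in\mathbb{Q}$ are defined by $$a(u^n_{X,\lambda,\rho},v)+\lambda(\mathcal{D}u^n_{X,\lambda,\rho},\mathcal{D}v)_Q=F(v)+\lambda G(\mathcal{D}v)-(\mathcal{D}v,p^{n-1}_{X,\lambda,\rho})_Q\quad\forall v\in\mathbb{V},$$ $$p^n_{X,\lambda,\rho}=p^{n-1}_{X,\lambda,\rho}+\rho(\mathcal{D}u^n_{X,\lambda,\rho}-\mathcal{R}_{\mathbb{Q}}^{-1}G).$$ These iterates and $u_{X,1/\lambda}$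 are well-defined for $\lambda>1/\epsilon_0$ (with $1/\infty=0$). Possible additional structure of $a$: (A1) $a$ is symmetric and there is $\tilde\alpha_X>0$ with $a(u,u)\ge0$ for all $u\in\mathbb{V}$ and $a(z,z)\ge\tilde\alpha_X\|z\|_V^2$ for all $z\in\mathbb{Z}$. (A2) there is $\tilde\alpha_X>0$ with $a(u,u)\ge\tilde\alpha_X\|u\|_V^2$ for all $u\in\mathbb{V}$. (A3) $a$ is symmetric and satisfies (A2). Constants, by case (in each case with the indicated $\Upsilon_X$); they are used with $\epsilon=1/\lambda$: - No additional assumption: $\Upsilon_X=1+\frac{M_a}{\alpha_X}$, $\epsilon_0=\frac1{M_a}\left(\frac{\beta_X}{\Upsilon_X}\right)^2$, $C_{X,\epsilon}^{[2]}=\frac{\Upsilon_X^2}{\beta_X^2}\frac{\epsilon_0}{\epsilon_0-\epsilon}$, $C_{X,\epsilon}^{[3]}=\frac{\Upsilon_X}{\beta_X}\frac{\epsilon_0}{\epsilon_0-\epsilon}$, $C_{X,\epsilon}^{[4]}=\frac{M_a\Upsilon_X}{\beta_X^2}\frac{\epsilon_0}{\epsilon_0-\epsilon}$. - (A1) (without (A2)): $\Upsilon_X=1+\sqrt{M_a/\tilde\alpha_X}$, $\epsilon_0=\infty$, $C_{X,\epsilon}^{[2]}=\frac{\Upsilon_X^2}{\beta_X^2}$, $C_{X,\epsilon}^{[3]}=\frac{\Upsilon_X}{\beta_X}$, $C_{X,\epsilon}^{[4]}=\frac{M_a}{\epsilon M_a+\beta_X^2}$. - (A2) (without symmetry): $\Upsilon_X=\frac{M_a}{\tilde\alpha_X}$,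 $\epsilon_0=\infty$, $C_{X,\epsilon}^{[2]}=\frac{\Upsilon_X^3}{\epsilon\tilde\alpha_X\Upsilon_X^2+\beta_X^2}$, $C_{X,\epsilon}^{[3]}=\frac{\Upsilon_XM_{\mathcal{D}}}{\sqrt{(\epsilon\tilde\alpha_X\Upsilon_X^2+\beta_X^2)(\epsilon\tilde\alpha_X+M_{\mathcal{D}}^2)}}$, $C_{X,\epsilon}^{[4]}=\frac{M_a\Upsilon_X}{\epsilon M_a\Upsilon_X+\beta_X^2}$. - (A3): $\Upsilon_X=\sqrt{M_a/\tilde\alpha_X}$, $\epsilon_0=\infty$, $C_{X,\epsilon}^{[2]}=\frac{\Upsilon_X^2}{\epsilon M_a+\beta_X^2}$, $C_{X,\epsilon}^{[3]}=\frac{\Upsilon_XM_{\mathcal{D}}}{\sqrt{(\epsilon\tilde\alpha_X\Upsilon_X^2+\beta_X^2)(\epsilon\tilde\alpha_X+M_{\mathcal{D}}^2)}}$, $C_{X,\epsilon}^{[4]}=\frac{M_a}{\epsilon M_a+\beta_X^2}$. Convention: $0^0=1$. *)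

(* Defs.v *)
From HB Require Import structures.
From mathcomp Require Export all_boot all_order all_algebra.
From mathcomp Require Export all_classical all_reals all_analysis.
Export Order.TTheory GRing.Theory Num.Theory.
Export numFieldNormedType.Exports.

Set Implicit Arguments.
Unset Strict Implicit.
Unset Printing Implicit Defensive.

Local Open Scope classical_set_scope.
Local Open Scope ring_scope.

(* Real Hilbert spaces: Banach spaces whose norm comes from an inner product. *)
HB.mixin Record CompleteNormedModule_isHilbert (R : realType) V
    of CompleteNormedModule R V := {
  inner : {dot V for (@idfun R)} ;
  inner_normE : forall v : V, `|v| = Num.sqrt (inner v v)
}.

#[short(type="hilbertType")]
HB.structure Definition Hilbert (R : realType) :=
  {V of CompleteNormedModule R V & CompleteNormedModule_isHilbert R V}.

Notation "''<' u , v >" := (inner u v)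
  (at level 2, u at level 69, v at level 69, format "''<' u ,  v >") : ring_scope.

Notation bilinear_form R V := {bilinear V -> V -> R | *%R & *%R}.

Definition finite_dim_subspace (R : realType) (V : lmodType R) (W : set V) :=
  exists (n : nat) (e : 'I_n -> V),
    W = [set v | exists c : 'I_n -> R, v = \sum_(i < n) c i *: e i].

(* A functional on the subspace [W] is a map on the whole space of which only
   the values on [W] are used.  No continuity is asked for, since every linear
   functional on a finite-dimensional subspace is continuous. *)
Definition linear_on (R : realType) (V : lmodType R) (W : set V) (f : V -> R) :=
  forall (c : R) (u v : V), W u -> W v -> f (c *: u + v) = c * f u + f v.

(* inf_{u in A} sup_{v in B} b(u,v) / (|u| |v|) over nonzero vectors, in the
   extended reals: the infimum over the empty set is +oo. *)
Definition infsup (R : realType) (U W : normedModType R)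
    (A : set U) (B : set W) (b : U -> W -> R) : \bar R :=
  ereal_inf [set ereal_sup [set (b u v / (`|u| * `|v|))%:E
                             | v in [set v | B v /\ v != 0]]
              | u in [set u | A u /\ u != 0]].

Section Constants.
Variables (R : realType) (V Q : hilbertType R).
Variables (a : bilinear_form R V) (D : {linear V -> Q}).
Variables (VX : set V) (QX : set Q).

Definition nullspace : set V := [set v | D v = 0].

Definition discrete_kernel : set V :=
  [set v | VX v /\ forall q, QX q -> '<D v, q> = 0].

(* The suprema below are finite for continuous [a] and bounded [D]; both
   constants are 0 when [V] is trivial. *)
Definition Ma : R :=
  sup [set r | exists u v : V,
         [/\ u != 0, v != 0 & r = a u v / (`|u| * `|v|)]].

Definition MD : R := sup [set r | exists2 v : V, v != 0 & r = `|D v| / `|v|].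

Definition alphaX : \bar R := infsup discrete_kernel discrete_kernel a.

Definition betaX : \bar R := infsup QX VX (fun q v => '<D v, q>).

(* Real value of [betaX], used in the formulas.  It differs from [betaX] only if
   [QX] is trivial, in which case [betaX] is +oo and this is 0. *)
Definition betaR : R := fine betaX.

(* The argument is the ellipticity constant. *)
Inductive structure :=
  | General
  | SymSemiElliptic of R
  | Elliptic of R
  | SymElliptic of R.

Definition has_structure (s : structure) : Prop :=
  match s with
  | General => True
  | SymSemiElliptic atilde =>
      [/\ forall u v, a u v = a v u,
          0 < atilde,
          forall u, VX u -> 0 <= a u u
        & forall z, discrete_kernel z -> atilde * `|z| ^+ 2 <= a z z]
  | Elliptic atilde =>
      0 < atilde /\ forall u, VX u -> atilde * `|u| ^+ 2 <= a u u
  | SymElliptic atilde =>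
      [/\ forall u v, a u v = a v u,
          0 < atilde
        & forall u, VX u -> atilde * `|u| ^+ 2 <= a u u]
  end.

Variable s : structure.

(* In the first case the quotient is taken in the extended reals, so that it is
   0 when [alphaX] is +oo, that is, when the discrete kernel is trivial. *)
Definition Upsilon : R :=
  match s with
  | General => 1 + fine (Ma%:E / alphaX)%E
  | SymSemiElliptic atilde => 1 + Num.sqrt (Ma / atilde)
  | Elliptic atilde => Ma / atilde
  | SymElliptic atilde => Num.sqrt (Ma / atilde)
  end.

Definition eps0 : \bar R :=
  match s with
  | General => (Ma%:E^-1 * (betaX / Upsilon%:E) ^+ 2)%E
  | _ => +oo%E
  end.

(* eps0 / (eps0 - eps), with limit 1 for eps0 = +oo. *)
Definition eps0_ratio (eps : R) : R :=
  if eps0 is e%:E then e / (e - eps) else 1.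

Definition C2 (eps : R) : R :=
  match s with
  | General => Upsilon ^+ 2 / betaR ^+ 2 * eps0_ratio eps
  | SymSemiElliptic _ => Upsilon ^+ 2 / betaR ^+ 2
  | Elliptic atilde => Upsilon ^+ 3 / (eps * atilde * Upsilon ^+ 2 + betaR ^+ 2)
  | SymElliptic _ => Upsilon ^+ 2 / (eps * Ma + betaR ^+ 2)
  end.

Definition C3 (eps : R) : R :=
  match s with
  | General => Upsilon / betaR * eps0_ratio eps
  | SymSemiElliptic _ => Upsilon / betaR
  | Elliptic atilde | SymElliptic atilde =>
      Upsilon * MD / Num.sqrt ((eps * atilde * Upsilon ^+ 2 + betaR ^+ 2)
                               * (eps * atilde + MD ^+ 2))
  end.

Definition C4 (eps : R) : R :=
  match s with
  | General => Ma * Upsilon / betaR ^+ 2 * eps0_ratio eps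
  | SymSemiElliptic _ | SymElliptic _ => Ma / (eps * Ma + betaR ^+ 2)
  | Elliptic _ => Ma * Upsilon / (eps * Ma * Upsilon + betaR ^+ 2)
  end.

Definition C23 (eps : R) : R := Num.min (MD * C2 eps) (C3 eps).

Definition eta (lambda rho : R) : R := `|1 - rho / lambda|.

Definition tau (lambda rho : R) : R :=
  rho * Ma / lambda ^+ 2
    * Num.min (C2 lambda^-1) (betaR^-1 * C3 lambda^-1)
  + eta lambda rho.

Definition xi (lambda rho : R) : R :=
  rho / lambda ^+ 2
    * Num.min (Ma / betaR * C23 lambda^-1) (C4 lambda^-1)
  + eta lambda rho.

End Constants.

Arguments General {R}.

Section Problems.
Variables (R : realType) (V Q : hilbertType R).
Variables (a : bilinear_form R V) (D : {linear V -> Q}).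
Variables (VX : set V) (QX : set Q) (F : V -> R) (G : Q -> R).

Definition saddle_point_solution (u : V) (p : Q) : Prop :=
  [/\ VX u, QX p,
      forall v, VX v -> a u v + '<D v, p> = F v
    & forall q, QX q -> '<D u, q> = G q].

Definition penalized_solution (lambda : R) (u : V) : Prop :=
  VX u /\
  forall v, VX v -> a u v + lambda * '<D u, D v> = F v + lambda * G (D v).

(* The Riesz map of [QX], as a functional on [Q] restricted to [QX], and its
   inverse: the element of [QX] representing [G] on [QX]. *)
Definition riesz (p : Q) : Q -> R := fun q => '<p, q>.

Definition riesz_inv : Q :=
  xget 0 [set p | QX p /\ forall q, QX q -> riesz p q = G q].

(* The value [u 0] is not constrained. *)
Definition iterated_penalty (lambda rho : R) (u : nat -> V) (p : nat -> Q)
    : Prop :=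
  p 0%N = 0 /\
  forall n : nat, (1 <= n)%N ->
    [/\ VX (u n), QX (p n),
        forall v, VX v ->
          a (u n) v + lambda * '<D (u n), D v>
          = F v + lambda * G (D v) - '<D v, p n.-1>
      & p n = p n.-1 + rho *: (D (u n) - riesz_inv)].

End Problems.

(* Main.v *)
(* Write [e n = u n - uX] and [d n = pX - p n].  Then [e n.+1] solves the penalized
   problem with right-hand side [v |-> <D v, d n>], and with the residual
   [h = d n - lambda D (e n.+1)] one has [a (e n.+1) v = <D v, h>] and
   [d n.+1 = (1 - rho/lambda) d n + (rho/lambda) h], so that [e n.+2] is
   [(1 - rho/lambda) e n.+1] plus the penalized response to [(rho/lambda) h].
   Everything thus reduces to bounding the response [w] to [g] and its residual:
   [w] is [a]-orthogonal to the discrete kernel, which together with a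
   norm-controlled preimage of [D w] gives [betaX |w| <= Upsilon |D w|], and
   testing the equation with [w] gives [|D w|^2 + a w w / lambda = <D w, g> / lambda].
   If [QX] is trivial, all errors vanish. *)

From mathcomp Require Import ring lra.
Require Import Defs.

Set Implicit Arguments.
Unset Strict Implicit.
Unset Printing Implicit Defensive.

Local Open Scope classical_set_scope.
Local Open Scope ring_scope.

(** * Inner product algebra and the Cauchy-Schwarz inequality *)

Section Inner.
Variables (R : realType) (H : hilbertType R).
Implicit Types x y : H.

Lemma innerC x y : '<x, y> = '<y, x>.
Proof. by rewrite hermC expr0 mul1r. Qed.

Lemma innerDl z x y : '<x + y, z> = '<x, z> + '<y, z>.
Proof. by rewrite linearDl. Qed.

Lemma innerDr z x y : '<z, x + y> = '<z, x> + '<z, y>.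
Proof. by rewrite linearDr. Qed.

Lemma innerZl c x y : '<c *: x, y> = c * '<x, y>.
Proof. by rewrite linearZl_LR. Qed.

Lemma innerZr c x y : '<x, c *: y> = c * '<x, y>.
Proof. by rewrite linearZr_LR. Qed.

Lemma innerBl z x y : '<x - y, z> = '<x, z> - '<y, z>.
Proof. by rewrite linearBl. Qed.

Lemma innerBr z x y : '<z, x - y> = '<z, x> - '<z, y>.
Proof. by rewrite linearBr. Qed.

Lemma innerE x : '<x, x> = `|x| ^+ 2.
Proof.
rewrite inner_normE sqr_sqrtr//.
have [->|/neq0_dnorm_gt0/ltW//] := eqVneq x 0.
by rewrite linear0l.
Qed.

Lemma inner_eq0 x : '<x, x> = 0 -> x = 0.
Proof. by rewrite innerE => /eqP; rewrite sqrf_eq0 normr_eq0 => /eqP. Qed.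

(** For nonzero [x], [y], expanding the squared norm of [|y| x - |x| y] gives
    [2 |x| |y| (|x| |y| - <x, y>) >= 0]. *)
Lemma inner_le x y : '<x, y> <= `|x| * `|y|.
Proof.
have [->|x0] := eqVneq x 0; first by rewrite linear0l normr0 mul0r.
have [->|y0] := eqVneq y 0; first by rewrite linear0r normr0 mulr0.
have := sqr_ge0 `| `|y| *: x - `|x| *: y |.
rewrite -innerE innerBl !innerBr !innerZl !innerZr !innerE (innerC y).
set c := '<x, y>; set A := `|x|; set B := `|y|.
have AB : 0 < A * B by rewrite mulr_gt0// normr_gt0.
have -> : B * (B * A ^+ 2) - B * (A * c) - (A * (B * c) - A * (A * B ^+ 2))
  = 2 * (A * B) * (A * B - c) by ring.
rewrite pmulr_rge0 ?subr_ge0//; lra.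
Qed.

End Inner.

(** * Finite-dimensional subspaces and Riesz representation on them *)

Section FiniteDimension.
Variables (R : realType) (H : hilbertType R).

Lemma subspace_lincomb (W : set H) (c : R) (u v : H) :
  finite_dim_subspace W -> W u -> W v -> W (c *: u + v).
Proof.
move=> [n [e ->]] [x ->] [y ->]; exists (fun i => c * x i + y i).
rewrite scaler_sumr -big_split/=; apply: eq_bigr => i _.
by rewrite scalerA scalerDl.
Qed.

Lemma subspace0 (W : set H) : finite_dim_subspace W -> W 0.
Proof.
by move=> [n [e ->]]; exists (fun=> 0); rewrite big1// => i _; rewrite scale0r.
Qed.

Lemma subspaceB (W : set H) (u v : H) :
  finite_dim_subspace W -> W u -> W v -> W (u - v).
Proof.
move=> Wfin Wu Wv; rewrite addrC -scaleN1r; exact: subspace_lincomb.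
Qed.

(* Induction on the spanning family: its last vector is replaced by its
   component orthogonal to the span of the others. *)
Lemma riesz_span n (e : 'I_n -> H) (f : H -> R) :
  let W := [set v | exists c : 'I_n -> R, v = \sum_(i < n) c i *: e i] in
  linear_on W f -> exists2 p, W p & forall q, W q -> '<p, q> = f q.
Proof.
elim: n e f => [|n IH] e f W flin.
  have W00 : W 0 by exists (fun=> 0); rewrite big_ord0.
  exists 0 => // q [c ->]; rewrite big_ord0 linear0l.
  have := flin 1 0 0 W00 W00; rewrite scale1r addr0 mul1r; lra.
pose e1 i := e (widen_ord (leqnSn n) i).
pose W1 := [set v | exists c : 'I_n -> R, v = \sum_(i < n) c i *: e1 i].
pose en := e ord_max.
have W1fin : finite_dim_subspace W1 by exists n, e1.
have Wfin : finite_dim_subspace W by exists n.+1, e.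
have Wsplit q : W q -> exists w c, W1 w /\ q = w + c *: en.
  move=> [c ->]; rewrite big_ord_recr/=.
  by exists (\sum_(i < n) c (widen_ord (leqnSn n) i) *: e1 i), (c ord_max);
    split => //; exists (fun i => c (widen_ord (leqnSn n) i)).
have W1W w : W1 w -> W w.
  move=> [c ->]; exists (fun i => if unlift ord_max i is Some j then c j else 0).
  rewrite big_ord_recr/= unlift_none scale0r addr0; apply: eq_bigr => i _.
  rewrite (_ : widen_ord _ i = lift ord_max i) ?liftK//.
    by rewrite -(_ : widen_ord (leqnSn n) i = lift ord_max i)//; apply: val_inj;
      rewrite /= /bump leqNgt ltn_ord.
  by apply: val_inj; rewrite /= /bump leqNgt ltn_ord.
have Wen : W en.
  exists (fun i => (i == ord_max)%:R); rewrite big_ord_recr/= eqxx scale1r.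
  rewrite big1 ?add0r// => i _; rewrite (_ : (_ == _) = false) ?scale0r//.
  by apply/negbTE; rewrite -val_eqE/= neq_ltn ltn_ord.
have [p0 W1p0 p0E] := IH e1 f (fun c u v W1u W1v => flin c u v (W1W _ W1u) (W1W _ W1v)).
(* [r] is the orthogonal projection of [en] onto [W1], obtained as the representer of [<en, .>]. *)
have [r W1r rE] : exists2 r, W1 r & forall q, W1 q -> '<r, q> = '<en, q>.
  by apply: IH => c u v _ _; rewrite innerDr innerZr.
pose z := en - r.
have Wz : W z by apply: subspaceB => //; exact: W1W.
have zorth q : W1 q -> '<z, q> = 0 by move=> W1q; rewrite innerBl rE// subrr.
have enE c w : w + c *: en = c *: z + (c *: r + w).
  by rewrite /z scalerBr addrA subrK addrC.
clearbody z.
exists (p0 + (f z / '<z, z>) *: z) => [|q /Wsplit[w [c [W1w ->]]]].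
  by rewrite addrC; apply: subspace_lincomb => //; exact: W1W.
have W1s : W1 (c *: r + w) by exact: subspace_lincomb.
rewrite enE flin//; last exact: W1W.
have p0z : '<p0, z> = 0 by rewrite innerC zorth.
rewrite innerDr innerZr !innerDl !innerZl (zorth _ W1s) (p0E _ W1s) p0z.
rewrite mulr0 addr0 add0r.
(* [z] vanishes when [en] lies in [W1]; the coefficient [f z / <z, z>] is then 0 by convention,
   which matches [f z = 0]. *)
have [z0|z0] := eqVneq '<z, z> 0; last by rewrite divfK.
have -> : f z = 0.
  rewrite (inner_eq0 z0); have W0 := subspace0 Wfin.
  have := flin 1 0 0 W0 W0; rewrite scale1r addr0 mul1r; lra.
by rewrite !mul0r.
Qed.

Lemma riesz_finite_dim (W : set H) (f : H -> R) :
  finite_dim_subspace W -> linear_on W f ->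
  exists2 p, W p & forall q, W q -> '<p, q> = f q.
Proof. by move=> [n [e ->]]; exact: riesz_span. Qed.

Lemma orthogonal_eq (W : set H) (p q : H) : finite_dim_subspace W ->
  W p -> W q -> (forall w, W w -> '<p, w> = '<q, w>) -> p = q.
Proof.
move=> Wfin Wp Wq pq; apply/eqP; rewrite -subr_eq0; apply/eqP/inner_eq0.
by rewrite innerBl pq ?subrr//; exact: subspaceB.
Qed.

End FiniteDimension.

(** * Inf-sup constants and operator norms turned into pointwise bounds *)

Lemma infsup_le (R : realType) (U W : normedModType R) (A : set U) (B : set W)
    (b : U -> W -> R) (u : U) (K : R) :
  A u -> u != 0 -> (forall v, B v -> b u v <= K * `|v|) ->
  (infsup A B b <= (K / `|u|)%:E)%E.
Proof.
move=> Au u0 bK; apply: le_trans (ereal_inf_lbound _) _; first by exists u.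
apply/ereal_supP => _ [v [Bv v0] <-]; rewrite lee_fin.
rewrite invfM mulrA mulrAC ler_pM2r ?invr_gt0 ?normr_gt0//.
by rewrite ler_pdivrMr ?normr_gt0// bK.
Qed.

(** [Ma] is a real supremum, so it bounds the quotients only once these are known to be bounded
    above. Continuity at the origin gives [|a| < 1] on a ball of radius [e]; rescaling both
    arguments to norm [e / 2] gives the bound [4 / e ^+ 2]. *)
Lemma bilinear_bound (R : realType) (V : hilbertType R) (a : bilinear_form R V) :
  continuous (fun uv : V * V => a uv.1 uv.2) ->
  forall u v, a u v <= Ma a * `|u| * `|v|.
Proof.
move=> a_cont.
have [M M0 aM] : exists2 M, 0 < M & forall u v, `|a u v| <= M * `|u| * `|v|.
  have /cvgrPdist_lt/(_ 1 ltr01) := a_cont (0, 0).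
  rewrite /= linear0l => /nbhs_ballP[e /= e0 ae].
  exists (4 / e ^+ 2) => [|u v]; first by rewrite divr_gt0// exprn_gt0.
  have [->|u0] := eqVneq u 0; first by rewrite linear0l !(normr0, mulr0, mul0r).
  have [->|v0] := eqVneq v 0; first by rewrite linear0r !(normr0, mulr0).
  have nu : 0 < `|u| by rewrite normr_gt0.
  have nv : 0 < `|v| by rewrite normr_gt0.
  pose s x : V := (e / 2 / `|x|) *: x.
  have sball x : x != 0 -> ball (0 : V) e (s x).
    move=> x0; rewrite -ball_normE/= sub0r normrN normrZ ger0_norm; last first.
      by rewrite !divr_ge0// ltW.
    by rewrite mulfVK ?normr_eq0//; lra.
  have := ae (s u, s v) (conj (sball _ u0) (sball _ v0)).
  rewrite /= sub0r normrN /s linearZl_LR/= linearZr_LR/=.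
  have s0 x : 0 <= e / 2 / `|x : V| by rewrite !divr_ge0// ltW.
  rewrite normrM (ger0_norm (s0 _)) normrM (ger0_norm (s0 _)).
  set x := `|a u v|; set A := `|u|; set B := `|v| => h.
  have K0 : 0 < 4 / e ^+ 2 * A * B by rewrite !mulr_gt0// invr_gt0 exprn_gt0.
  have -> : x = e / 2 / A * (e / 2 / B * x) * (4 / e ^+ 2 * A * B).
    by field; rewrite !gt_eqF.
  by rewrite ger_pMl//; exact: ltW.
move=> u v.
have [->|u0] := eqVneq u 0; first by rewrite linear0l !(normr0, mulr0, mul0r).
have [->|v0] := eqVneq v 0; first by rewrite linear0r !(normr0, mulr0).
have nu : 0 < `|u| by rewrite normr_gt0.
have nv : 0 < `|v| by rewrite normr_gt0.
rewrite -mulrA -ler_pdivrMr ?mulr_gt0//; apply: ub_le_sup; last by exists u, v.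
exists M => _ [x [y [x0 y0 ->]]].
by rewrite ler_pdivrMr ?mulr_gt0 ?normr_gt0// mulrA (le_trans (ler_norm _)).
Qed.

(** The bounds for [a v v] and [a v (- v)] add up to [0 <= 2 Ma |v|^2]; for trivial [V] the supremum
    is over the empty set and equals 0. *)
Lemma bilinear_norm_ge0 (R : realType) (V : hilbertType R) (a : bilinear_form R V) :
  continuous (fun uv : V * V => a uv.1 uv.2) -> 0 <= Ma a.
Proof.
move=> a_cont; have [[v v0]|V0] := pselect (exists v : V, v != 0).
  have := bilinear_bound a_cont v v; have := bilinear_bound a_cont v (- v).
  rewrite normrN linearNr => /= h1 h2.
  have : 0 < `|v| * `|v| by rewrite mulr_gt0 ?normr_gt0.
  by move=> h; rewrite -(pmulr_lge0 _ h) mulrA; lra.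
rewrite /Ma (_ : [set _ | _] = set0) ?sup0//.
by rewrite -subset0 => r [u [v [u0 _ _]]]; apply: V0; exists u.
Qed.

Lemma bounded_linear_bound (R : realType) (V Q : hilbertType R) (D : {linear V -> Q}) :
  bounded_near D (nbhs (0 : V)) -> forall v, `|D v| <= MD D * `|v|.
Proof.
move=> /linear_boundedP/pinfty_ex_gt0[M M0 DM] v.
have [->|v0] := eqVneq v 0; first by rewrite linear0 !normr0 mulr0.
have nv : 0 < `|v| by rewrite normr_gt0.
rewrite -ler_pdivrMr//; apply: ub_le_sup; last by exists v.
by exists M => _ [x x0 ->]; rewrite ler_pdivrMr ?normr_gt0.
Qed.

Lemma linear_norm_ge0 (R : realType) (V Q : hilbertType R) (D : {linear V -> Q}) :
  bounded_near D (nbhs (0 : V)) -> 0 <= MD D.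
Proof.
move=> D_bounded; have [[v v0]|V0] := pselect (exists v : V, v != 0).
  have nv : 0 < `|v| by rewrite normr_gt0.
  rewrite -(pmulr_lge0 _ nv).
  exact: le_trans (normr_ge0 _) (bounded_linear_bound D_bounded v).
rewrite /MD (_ : [set _ | _] = set0) ?sup0//.
by rewrite -subset0 => r [v v0 _]; apply: V0; exists v.
Qed.

Lemma sqr_le_cancel (R : realDomainType) (x y : R) :
  0 <= y -> x ^+ 2 <= y * x -> x <= y.
Proof.
move=> y0 xy; have [//|yx] := leP x y.
have x0 : 0 < x by exact: le_lt_trans yx.
move: xy; rewrite expr2 (ler_pM2r x0); lra.
Qed.

(** * Consequences of the discrete inf-sup conditions *)

Section Discretization.
Variables (R : realType) (V Q : hilbertType R).
Variables (a : bilinear_form R V) (D : {linear V -> Q}).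
Hypothesis a_cont : continuous (fun uv : V * V => a uv.1 uv.2).
Hypothesis D_bounded : bounded_near D (nbhs (0 : V)).
Variables (VX : set V) (QX : set Q).
Hypothesis VX_fin : finite_dim_subspace VX.
Hypothesis QX_fin : finite_dim_subspace QX.
Hypothesis D_VX : D @` VX = QX.
Hypothesis alphaX_gt0 : (0 < alphaX a D VX QX)%E.
Hypothesis betaX_gt0 : (0 < betaX D VX QX)%E.

Local Notation Z := (discrete_kernel D VX QX).
Local Notation beta := (betaR D VX QX).

Lemma image_QX v : VX v -> QX (D v).
Proof. by move=> VXv; rewrite -D_VX; exists v. Qed.

(** As [D] maps [VX] into [QX], the test element [q := D z] is admissible, so [D z] is orthogonal to
    itself. *)
Lemma discrete_kernelP z : Z z <-> VX z /\ D z = 0.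
Proof.
split=> [[VXz Dz]|[VXz Dz]]; split=> //.
  by apply/inner_eq0/Dz/image_QX.
by move=> q _; rewrite Dz linear0l.
Qed.

(** A nonzero [q] in [QX] bounds the infimum by [MD], so passing to the real number [betaR] loses
    nothing. *)
Lemma betaX_finite (q : Q) : QX q -> q != 0 -> betaX D VX QX = beta%:E.
Proof.
move=> QXq q0; rewrite /betaR fineK// fin_numE gt_eqF/=; last first.
  exact: lt_trans betaX_gt0.
have /(@infsup_le _ _ _ QX VX (fun q v => '<D v, q>) q (MD D * `|q|) QXq q0) :
    forall v, VX v -> '<D v, q> <= MD D * `|q| * `|v|.
  move=> v _; rewrite mulrAC; apply: le_trans (inner_le _ _) _.
  by rewrite ler_wpM2r//; exact: bounded_linear_bound.
by rewrite -/(betaX D VX QX); case: (betaX D VX QX).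
Qed.

Lemma betaR_ge0 : 0 <= beta.
Proof. by rewrite fine_ge0// ltW. Qed.

Lemma betaR_gt0 (q : Q) : QX q -> q != 0 -> 0 < beta.
Proof. by move=> QXq q0; rewrite -lte_fin -(betaX_finite QXq q0). Qed.

(** The form in which the inf-sup condition is used: it bounds the adjoint of [D] from below. *)
Lemma betaR_le (q : Q) (K : R) : 0 <= K -> QX q ->
  (forall v, VX v -> '<D v, q> <= K * `|v|) -> beta * `|q| <= K.
Proof.
move=> K0 QXq qK; have [->|q0] := eqVneq q 0; first by rewrite normr0 mulr0.
rewrite -ler_pdivlMr ?normr_gt0// -lee_fin -(betaX_finite QXq q0).
exact: infsup_le.
Qed.

(** This set is the range of the adjoint of [D] restricted to [VX], spanned by the representers
    [w i] of [v |-> <D v, e i>]. Finite dimension permits the orthogonal projection onto it. *)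
Lemma adjoint_range_finite_dim :
  finite_dim_subspace [set u | VX u /\ exists2 q, QX q &
    forall v, VX v -> '<u, v> = '<D v, q> ].
Proof.
have [n [e QXe]] := QX_fin.
have QXei i : QX (e i).
  rewrite QXe; exists (fun j => (j == i)%:R).
  rewrite (bigD1 i)//= eqxx scale1r big1 ?addr0// => j /negbTE ->.
  by rewrite scale0r.
have /choice[w wP] : forall i, exists w, VX w /\ forall v, VX v -> '<w, v> = '<D v, e i>.
  move=> i; have [|w VXw wE] := @riesz_finite_dim _ _ VX (fun v => '<D v, e i>) VX_fin.
    by move=> c u v _ _; rewrite linearP /= innerDl innerZl.
  by exists w.
have VXsum (c : 'I_n -> R) : VX (\sum_(i < n) c i *: w i).
  elim/big_ind: _ => [|u v VXu VXv|i _].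
  - exact: subspace0.
  - by rewrite -[u]scale1r; exact: subspace_lincomb.
  - rewrite -[_ *: _]addr0; apply: subspace_lincomb (subspace0 _) => //.
    exact: (wP i).1.
have sumE (c : 'I_n -> R) v : VX v ->
    '<(\sum_(i < n) c i *: w i), v> = '<D v, (\sum_(i < n) c i *: e i)>.
  move=> VXv; rewrite linear_sumlz linear_sumr; apply: eq_bigr => i _ /=.
  by rewrite innerZl innerZr (wP i).2.
exists n, w; apply/seteqP; split=> [u [VXu [q]]|_ [c ->]] /=.
  rewrite {1}QXe => -[c ->] uE; exists c.
  by apply: (orthogonal_eq VX_fin) => // v VXv; rewrite uE// sumE.
by split=> //; exists (\sum_(i < n) c i *: e i) => [|v /sumE//]; rewrite QXe; exists c.
Qed.

(* The preimage of [q] of minimal norm: it lies in the range of the adjoint. *)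
Lemma lift_bound (q : Q) : QX q ->
  exists v, [/\ VX v, D v = q & beta * `|v| <= `|q|].
Proof.
move=> QXq; have := QXq; rewrite -{1}D_VX => -[v0 VXv0 Dv0].
(* [v] is the orthogonal projection of an arbitrary preimage [v0] onto the adjoint range. *)
have [|v [VXv [r QXr vE]] v0E] :=
  riesz_finite_dim (f := fun u => '<v0, u>) adjoint_range_finite_dim.
  by move=> c u w _ _; rewrite innerDr innerZr.
(* For [p] in [QX] the representer of [<D ., p>] lies in the adjoint range, where [v] and [v0] have
   the same inner products. *)
have Dv : D v = q.
  apply: (orthogonal_eq QX_fin) => // [|p QXp]; first exact: image_QX.
  have [|w VXw wE] := @riesz_finite_dim _ _ VX (fun v => '<D v, p>) VX_fin.
    by move=> c u w _ _; rewrite linearP /= innerDl innerZl.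
  rewrite -wE// innerC v0E; last by split=> //; exists p.
  by rewrite innerC wE// Dv0.
exists v; split=> //.
have rv : beta * `|r| <= `|v|.
  by apply: betaR_le => // u VXu; rewrite -vE//; exact: inner_le.
(* [|v|^2 = <D v, r> = <q, r> <= |q| |r|], and [rv] turns this into
   [(beta |v|)^2 <= |q| (beta |v|)]. *)
apply: sqr_le_cancel => //.
rewrite exprMn -innerE vE// Dv expr2 -mulrA mulrCA.
apply: (ler_wpM2l betaR_ge0); apply: le_trans (ler_wpM2l betaR_ge0 (inner_le q r)) _.
by rewrite mulrCA ler_wpM2l.
Qed.

(** The factor [Ma] in the hypothesis makes the constant the quotient occurring in [Upsilon]. If the
    kernel is trivial, only [z = 0] remains. *)
Lemma kernel_le (z : V) (k : R) : Z z -> 0 <= k ->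
  (forall z', Z z' -> a z z' <= Ma a * k * `|z'|) ->
  `|z| <= fine ((Ma a)%:E / alphaX a D VX QX)%E * k.
Proof.
move=> Zz k0 az.
have [->|z0] := eqVneq z 0.
  rewrite normr0 mulr_ge0// fine_ge0// mule_ge0//.
    by rewrite lee_fin bilinear_norm_ge0.
  by rewrite inve_ge0 ltW.
have nz : 0 < `|z| by rewrite normr_gt0.
have := infsup_le Zz z0 az; rewrite -/(alphaX a D VX QX).
move: alphaX_gt0; case: (alphaX a D VX QX) => [r| |]//=.
rewrite lte_fin lee_fin => r0; rewrite inver gt_eqF//= ler_pdivlMr// => rz.
by rewrite mulrAC ler_pdivlMr// mulrC.
Qed.

(** * Response of the penalized problem to a functional [v |-> <D v, g>] *)

Section Structure.
Variable s : structure R.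
Hypothesis a_s : has_structure a D VX QX s.

Local Notation Ups := (Upsilon a D VX QX s).

Lemma kernel_orthogonal_eq w v : (forall z, Z z -> a w z = 0) ->
  VX w -> VX v -> D w = D v -> a w w = a w v.
Proof.
move=> wZ VXw VXv Dwv; apply/eqP; rewrite -subr_eq0 -linearBr/=; apply/eqP/wZ.
by apply/discrete_kernelP; split; [exact: subspaceB|rewrite linearB Dwv subrr].
Qed.

(** [v - w] lies in the discrete kernel, on which [a w] vanishes. In the general case
    [a (v - w) z = a v z] there, and the inf-sup condition bounds [|v - w|]. In the symmetric cases
    [a v v = a w w + a (v - w) (v - w)], and coercivity is applied to [v - w] or to [w]. In the
    elliptic case [a w w = a w v] suffices. *)
Lemma Upsilon_lift w v : (forall z, Z z -> a w z = 0) ->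
  VX w -> VX v -> D w = D v -> `|w| <= Ups * `|v|.
Proof.
move=> wZ VXw VXv Dwv.
have M0 := bilinear_norm_ge0 a_cont.
have aM u1 u2 := bilinear_bound a_cont u1 u2.
have Zvw : Z (v - w).
  by apply/discrete_kernelP; split; [exact: subspaceB|rewrite linearB Dwv subrr].
have awwv : a w w = a w v by exact: kernel_orthogonal_eq.
have wv : `|w| <= `|v| + `|v - w|.
  by rewrite -{1}[w](subKr v) (le_trans (ler_normB _ _)).
have energy : (forall u1 u2, a u1 u2 = a u2 u1) ->
    a v v = a w w + a (v - w) (v - w).
  move=> asym; rewrite linearBl/= !linearBr/= (asym v w) -awwv; ring.
case: s a_s => [|at'|at'|at'] /=.
- move=> _; apply: le_trans wv _; rewrite mulrDl mul1r lerD2l.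
  apply: kernel_le => // z Zz; rewrite linearBl/= wZ// subr0.
  exact: aM.
- move=> [asym at0 app acoer]; apply: le_trans wv _.
  rewrite mulrDl mul1r lerD2l.
  rewrite -(@ler_pXn2r _ 2)// ?nnegrE ?mulr_ge0 ?sqrtr_ge0//.
  rewrite exprMn sqr_sqrtr ?divr_ge0// ?(ltW at0)//.
  rewrite mulrAC ler_pdivlMr// mulrC.
  apply: le_trans (acoer _ Zvw) _.
  have := energy asym; have := app _ VXw; have := aM v v; rewrite -mulrA -expr2; lra.
- move=> [at0 acoer].
  apply: sqr_le_cancel; first by rewrite mulr_ge0// divr_ge0// ltW.
  rewrite -(ler_pM2l at0).
  have -> : at' * (Ma a / at' * `|v| * `|w|) = Ma a * `|w| * `|v|.
    by field; rewrite gt_eqF.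
  by rewrite (le_trans (acoer _ VXw))// awwv.
- move=> [asym at0 acoer].
  rewrite -(@ler_pXn2r _ 2)// ?nnegrE ?mulr_ge0 ?sqrtr_ge0//.
  rewrite exprMn sqr_sqrtr ?divr_ge0// ?(ltW at0)//.
  rewrite mulrAC ler_pdivlMr// mulrC.
  apply: le_trans (acoer _ VXw) _.
  have : 0 <= a (v - w) (v - w).
    by apply: le_trans (acoer _ Zvw.1); rewrite mulr_ge0 ?exprn_ge0// ltW.
  have := energy asym; have := aM v v; rewrite -mulrA -expr2; lra.
Qed.

Lemma Upsilon_ge0 : 0 <= Ups.
Proof.
have M0 := bilinear_norm_ge0 a_cont.
case: s a_s => [|at'|at'|at'] /=.
- rewrite addr_ge0// fine_ge0// mule_ge0 ?lee_fin// inve_ge0; exact: ltW.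
- by rewrite addr_ge0// sqrtr_ge0.
- by move=> [at0 _]; rewrite divr_ge0// ltW.
- by rewrite sqrtr_ge0.
Qed.

(** * Energy balance of the response [w] and of its residual [h] *)

Hypothesis beta_gt0 : 0 < beta.
Variable lambda : R.
Hypothesis lambda_gt0 : 0 < lambda.
Hypothesis lambda_gt : ((eps0 a D VX QX s)^-1 < lambda%:E)%E.

Local Notation eps := lambda^-1.

(** The subtracted term is [eps / eps0], and [lambda > 1 / eps0] means [eps < eps0]. *)
Lemma eps0_ratioP : s = General -> betaX D VX QX = beta%:E ->
  eps0_ratio a D VX QX s eps * (1 - eps * Ma a * (Ups / beta) ^+ 2) = 1
  /\ 0 < eps0_ratio a D VX QX s eps.
Proof.
move=> sG betaE; have M0 := bilinear_norm_ge0 a_cont.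
have Ups0 : 0 < Ups.
  rewrite sG /= ltr_pwDl// fine_ge0// mule_ge0 ?lee_fin// inve_ge0; exact: ltW.
move: lambda_gt; rewrite /eps0_ratio.
have -> : eps0 a D VX QX s = ((Ma a)%:E^-1 * (betaX D VX QX / Ups%:E) ^+ 2)%E.
  by rewrite {1}sG /eps0 sG.
rewrite betaE (inver Ups) (gt_eqF Ups0) -EFinM -EFin_expe (inver (Ma a)).
(* For [Ma = 0] the threshold [eps0] is [+oo] and the ratio takes its limit value 1. *)
have [->|Mneq] := eqVneq (Ma a) 0.
  rewrite gt0_mulye ?lte_fin ?exprn_gt0 ?divr_gt0//= => _.
  by rewrite mulr0 mul0r subr0 mul1r.
have Mgt : 0 < Ma a by rewrite lt_neqAle eq_sym Mneq.
rewrite -EFinM; set e0 := (Ma a)^-1 * (beta / Ups) ^+ 2.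
have e0_gt0 : 0 < e0 by rewrite mulr_gt0 ?invr_gt0 ?exprn_gt0 ?divr_gt0.
rewrite (inver e0) (gt_eqF e0_gt0) lte_fin => e0l.
have le0 : eps < e0 by rewrite -[e0]invrK ltf_pV2 ?posrE ?invr_gt0.
split; last by rewrite divr_gt0 ?subr_gt0.
have -> : eps * Ma a * (Ups / beta) ^+ 2 = eps / e0.
  by rewrite /e0; field; rewrite !gt_eqF.
by move: le0; generalize eps => t te0; field; rewrite !gt_eqF ?subr_gt0.
Qed.

Variables (g : Q) (w : V).
Hypothesis QXg : QX g.
Hypothesis VXw : VX w.
Hypothesis w_eq : forall v, VX v -> a w v + lambda * '<D w, D v> = '<D v, g>.

Local Notation h := (g - lambda *: D w).

Lemma residualE v : VX v -> a w v = '<D v, h>.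
Proof. by move=> VXv; rewrite innerBr innerZr (innerC _ (D w)) -w_eq// addrK. Qed.

Lemma response_orthogonal z : Z z -> a w z = 0.
Proof. by move=> /discrete_kernelP[VXz Dz]; rewrite residualE// Dz linear0l. Qed.

Lemma response_Upsilon : beta * `|w| <= Ups * `|D w|.
Proof.
have [v [VXv Dv vle]] := lift_bound (image_QX VXw).
have := Upsilon_lift response_orthogonal VXw VXv (esym Dv).
move=> /(ler_wpM2l (ltW beta_gt0)) h1; apply: le_trans h1 _.
by rewrite mulrCA ler_wpM2l ?Upsilon_ge0.
Qed.

Lemma response_energy : `|D w| ^+ 2 + eps * a w w = eps * '<D w, g>.
Proof.
rewrite -w_eq// -innerE mulrDr mulrA mulVf ?mul1r 1?addrC//.
by rewrite gt_eqF.
Qed.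

(** Insert [D w = eps (g - h)] into [a w w = <D w, h>]. *)
Lemma residual_energy : a w w = eps * ('<g, h> - `|h| ^+ 2).
Proof.
rewrite residualE// -[`|h| ^+ 2]innerE -innerBl subKr innerZl mulrA mulVf ?mul1r//.
by rewrite gt_eqF.
Qed.

Lemma residual_QX : QX h.
Proof.
rewrite -scaleNr addrC; apply: subspace_lincomb => //; exact: image_QX.
Qed.

Lemma residual_le : beta * `|h| <= Ma a * `|w|.
Proof.
apply: betaR_le; first by rewrite mulr_ge0// bilinear_norm_ge0.
  exact: residual_QX.
by move=> v VXv; rewrite -residualE// bilinear_bound.
Qed.

(** The factor [r] accounts for a possibly negative [a w w]: it is [eps0_ratio] in the general case
    and 1 when [a] is nonnegative on [VX]. *)
Lemma response_le_energy r : 0 <= r -> `|D w| ^+ 2 <= r * eps * '<D w, g> ->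
  `|w| <= eps * (Ups / beta * r) * `|g|.
Proof.
move=> r0 Dw_le; have eps0 : 0 <= eps by rewrite invr_ge0 ltW.
have : `|D w| <= r * eps * `|g|.
  apply: sqr_le_cancel; first by rewrite !mulr_ge0.
  apply: le_trans Dw_le _; rewrite -[leRHS]mulrA; apply: ler_wpM2l.
    by rewrite mulr_ge0.
  by rewrite mulrC inner_le.
move=> /(ler_wpM2l Upsilon_ge0)/(le_trans response_Upsilon).
rewrite mulrC -ler_pdivlMr// => /le_trans; apply.
by rewrite le_eqVlt; apply/predU1P; left; field; rewrite !gt_eqF.
Qed.

(** [response_Upsilon] enters twice, which squares [Ups / beta]: once to bound [<D w, g>] by
    [|D w|], once to return from [|D w|] to [|w|]. *)
Lemma response_le_energy_dual r K : 0 <= r -> 0 <= K ->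
  `|D w| ^+ 2 <= r * eps * '<D w, g> -> '<D w, g> <= K * `|w| ->
  `|w| <= eps * (Ups ^+ 2 / beta ^+ 2 * r) * K.
Proof.
move=> r0 K0 Dw_le gK; have eps0 : 0 <= eps by rewrite invr_ge0 ltW.
have w_le : `|w| <= Ups / beta * `|D w|.
  by rewrite mulrAC ler_pdivlMr// mulrC response_Upsilon.
have kappa0 : 0 <= Ups / beta by rewrite divr_ge0 ?Upsilon_ge0// ltW.
have : `|D w| <= r * eps * K * (Ups / beta).
  apply: sqr_le_cancel; first by rewrite mulr_ge0// !mulr_ge0.
  apply: le_trans Dw_le _.
  rewrite (_ : _ * `|D w| = r * eps * (K * (Ups / beta * `|D w|))); last by ring.
  apply: ler_wpM2l; first by rewrite mulr_ge0.
  by apply: le_trans gK _; rewrite ler_wpM2l.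
move=> /(ler_wpM2l kappa0)/(le_trans w_le) /le_trans; apply.
by rewrite le_eqVlt; apply/predU1P; left; field; rewrite !gt_eqF.
Qed.

Lemma eps_ge0 : 0 <= eps.
Proof. by rewrite invr_ge0 ltW. Qed.

(** Multiplied by [Ups ^+ 2], the left-hand side of the energy bound dominates
    [(c Ups^2 + beta^2) |w|^2]; then [|w|] is cancelled. *)
Lemma response_elliptic_dual c K : 0 <= c -> 0 <= K ->
  `|D w| ^+ 2 + c * `|w| ^+ 2 <= eps * '<D w, g> -> '<D w, g> <= K * `|w| ->
  `|w| <= eps * (Ups ^+ 2 / (c * Ups ^+ 2 + beta ^+ 2)) * K.
Proof.
move=> c0 K0 Dw_le gK; have e0 := eps_ge0.
have den : 0 < c * Ups ^+ 2 + beta ^+ 2.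
  by rewrite ltr_wpDl ?exprn_gt0// mulr_ge0// sqr_ge0.
rewrite mulrA mulrAC ler_pdivlMr//.
have : (beta * `|w|) ^+ 2 <= (Ups * `|D w|) ^+ 2.
  by rewrite ler_pXn2r// ?nnegrE ?mulr_ge0 ?Upsilon_ge0 ?response_Upsilon// ltW.
have : Ups ^+ 2 * (`|D w| ^+ 2 + c * `|w| ^+ 2) <= Ups ^+ 2 * (eps * (K * `|w|)).
  apply: ler_wpM2l; first exact: sqr_ge0.
  by apply: le_trans Dw_le _; exact: ler_wpM2l.
rewrite !exprMn => h1 h2.
have [->|w0] := eqVneq w 0; first by rewrite normr0 mul0r !mulr_ge0// Upsilon_ge0.
have nw : 0 < `|w| by rewrite normr_gt0.
rewrite -(ler_pM2r nw); lra.
Qed.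

(* For [t := |D w| / |w|] one has [|w| <= eps |g| t / (t^2 + c)], and
   [t / (t^2 + c) <= MD / sqrt (((beta / Ups)^2 + c) (MD^2 + c))] as
   [beta / Ups <= t <= MD]; the proof avoids the quotients by squaring. *)
Lemma response_elliptic c : 0 <= c ->
  `|D w| ^+ 2 + c * `|w| ^+ 2 <= eps * '<D w, g> ->
  `|w| <= eps * (Ups * MD D
    / Num.sqrt ((c * Ups ^+ 2 + beta ^+ 2) * (c + MD D ^+ 2))) * `|g|.
Proof.
move=> c0 Dw_le; have e0 := eps_ge0; have U0 := Upsilon_ge0.
have M0 := linear_norm_ge0 D_bounded.
have [w0|w0] := eqVneq w 0.
  by rewrite w0 normr0 mulr_ge0// mulr_ge0// divr_ge0 ?mulr_ge0 ?sqrtr_ge0.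
have nw : 0 < `|w| by rewrite normr_gt0.
have k_le := response_Upsilon; have d_le := bounded_linear_bound D_bounded w.
have d0 : 0 < `|D w|.
  rewrite lt_neqAle normr_ge0 andbT eq_sym; apply: contraTneq k_le => ->.
  by rewrite mulr0 -ltNge mulr_gt0.
have MD0 : 0 < MD D.
  by rewrite -(pmulr_lgt0 _ nw); exact: lt_le_trans d_le.
have E_le : `|D w| ^+ 2 + c * `|w| ^+ 2 <= eps * (`|D w| * `|g|).
  by apply: le_trans Dw_le _; apply: ler_wpM2l => //; exact: inner_le.
have P0 : 0 < (c * Ups ^+ 2 + beta ^+ 2) * (c + MD D ^+ 2).
  by rewrite mulr_gt0// ltr_wpDl ?exprn_gt0// mulr_ge0// sqr_ge0.
set P := (_ * _) in P0 *.
have sP : 0 < Num.sqrt P by rewrite sqrtr_gt0.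
rewrite mulrA mulrAC ler_pdivlMr//.
rewrite -(@ler_pXn2r _ 2)// ?nnegrE ?mulr_ge0// ?(ltW sP)//.
rewrite exprMn sqr_sqrtr ?(ltW P0)//.
have k2_le : (beta * `|w|) ^+ 2 <= (Ups * `|D w|) ^+ 2.
  by rewrite ler_pXn2r// ?nnegrE ?mulr_ge0// ltW.
have d2_le : `|D w| ^+ 2 <= (MD D * `|w|) ^+ 2.
  by rewrite ler_pXn2r// nnegrE// mulr_ge0.
have E2_le : (`|D w| ^+ 2 + c * `|w| ^+ 2) ^+ 2 <= (eps * (`|D w| * `|g|)) ^+ 2.
  by rewrite ler_pXn2r// ?nnegrE ?addr_ge0 ?mulr_ge0 ?sqr_ge0.
(* With the factor [|D w|^2] the left-hand side is the product of those of [kE] and [dE] below,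
   hence at most [(U M)^2 E^2], to which the squared energy bound applies. *)
rewrite -(ler_pM2r (exprn_gt0 2 d0)) /P.
move: k2_le d2_le E2_le U0 M0 c0 d0 nw.
set d := `|D w|; set k := `|w|; set M := MD D; set E := d ^+ 2 + c * k ^+ 2.
set G := `|g|; set U := Ups; set b := beta => k2_le d2_le E2_le U0 M0 c0 d0 nw.
have E0 : 0 <= E by rewrite addr_ge0 ?sqr_ge0// mulr_ge0// sqr_ge0.
have kE : k ^+ 2 * (c * U ^+ 2 + b ^+ 2) <= U ^+ 2 * E.
  by move: k2_le; rewrite !exprMn /E; lra.
have dE : (c + M ^+ 2) * d ^+ 2 <= M ^+ 2 * E.
  have := ler_wpM2l c0 d2_le; rewrite exprMn /E; lra.
apply: (@le_trans _ _ (U ^+ 2 * E * (M ^+ 2 * E))).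
  rewrite (_ : _ * d ^+ 2 = k ^+ 2 * (c * U ^+ 2 + b ^+ 2) * ((c + M ^+ 2) * d ^+ 2)).
    apply: ler_pM kE dE.
      by rewrite mulr_ge0 ?sqr_ge0// addr_ge0 ?sqr_ge0// mulr_ge0// sqr_ge0.
    by rewrite mulr_ge0 ?sqr_ge0// addr_ge0 ?sqr_ge0.
  by ring.
rewrite (_ : _ * E * _ = (U * M) ^+ 2 * E ^+ 2); last by ring.
rewrite (_ : _ * d ^+ 2 = (U * M) ^+ 2 * (eps * (d * G)) ^+ 2); last by ring.
by apply: ler_wpM2l => //; exact: sqr_ge0.
Qed.

(** By [residual_energy] the hypothesis contains [- eps N |h|^2] on the right; moved to the left, it
    gives the term [eps N] of the denominator. *)
Lemma residual_le_energy N : 0 <= N -> (beta * `|h|) ^+ 2 <= N * a w w ->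
  `|h| <= eps * (N / (eps * N + beta ^+ 2)) * `|g|.
Proof.
move=> N0; rewrite residual_energy => hN; have e0 := eps_ge0.
have den : 0 < eps * N + beta ^+ 2.
  by rewrite ltr_wpDl ?exprn_gt0// mulr_ge0.
rewrite mulrA mulrAC ler_pdivlMr//.
have [->|h0] := eqVneq h 0; first by rewrite normr0 mul0r !mulr_ge0.
have nh : 0 < `|h| by rewrite normr_gt0.
rewrite -(ler_pM2r nh).
have := ler_wpM2l (mulr_ge0 e0 N0) (inner_le g h).
move: hN; rewrite exprMn; lra.
Qed.

Lemma form_CauchySchwarz v : (forall u1 u2, a u1 u2 = a u2 u1) ->
  (forall u, VX u -> 0 <= a u u) -> VX v -> (a w v) ^+ 2 <= a w w * a v v.
Proof.
move=> asym app VXv.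
have quad t : 0 <= a w w - 2 * t * a w v + t ^+ 2 * a v v.
  have /app : VX (w - t *: v).
    by rewrite addrC -scaleNr; exact: subspace_lincomb.
  have aZl c x y : a (c *: x) y = c * a x y by rewrite linearZl_LR.
  have aZr c x y : a x (c *: y) = c * a x y by rewrite linearZr_LR.
  rewrite linearBl/= !linearBr/= !(aZl, aZr) (asym v w); lra.
have := app _ VXv; have := app _ VXw.
move: (a w w) (a w v) (a v v) quad => A B C quad A0.
rewrite le_eqVlt => /predU1P[C0|C0].
  move: quad; rewrite -C0 mulr0 => quad.
  have [->|B0] := eqVneq B 0; first by rewrite expr0n.
  (* When [a v v = 0] the quadratic is affine in [t]; this [t] would give it the value [-1], so
     [a w v] must vanish. *)
  have := quad ((A + 1) / (2 * B)); rewrite mulr0 addr0.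
  rewrite (_ : 2 * _ * B = A + 1); last by field.
  lra.
have := quad (B / C).
rewrite (_ : _ + _ = (A * C - B ^+ 2) / C); last by field; rewrite gt_eqF.
by rewrite pmulr_lge0 ?invr_gt0// subr_ge0.
Qed.

(** Cauchy-Schwarz for [a] bounds [<D v, h> = a w v] by [sqrt (Ma * a w w) |v|], and the inf-sup
    condition passes this on to [h]. *)
Lemma residual_le_sym : (forall u1 u2, a u1 u2 = a u2 u1) ->
  (forall u, VX u -> 0 <= a u u) -> (beta * `|h|) ^+ 2 <= Ma a * a w w.
Proof.
move=> asym app; have M0 := bilinear_norm_ge0 a_cont.
have A0 := app _ VXw.
rewrite -[leRHS]sqr_sqrtr ?mulr_ge0//.
rewrite ler_pXn2r ?nnegrE ?sqrtr_ge0 ?mulr_ge0// ?(ltW beta_gt0)//.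
apply: betaR_le; rewrite ?sqrtr_ge0//; first exact: residual_QX.
move=> v VXv; rewrite -residualE//; apply: le_trans (ler_norm _) _.
rewrite -(@ler_pXn2r _ 2)// ?nnegrE ?mulr_ge0 ?sqrtr_ge0//.
rewrite real_normK ?num_real// exprMn sqr_sqrtr ?mulr_ge0//.
apply: le_trans (form_CauchySchwarz asym app VXv) _.
rewrite (mulrC (Ma a)) -mulrA; apply: ler_wpM2l => //.
by rewrite expr2 mulrA; exact: bilinear_bound.
Qed.

Lemma betaX_EFin : betaX D VX QX = beta%:E.
Proof.
by move: beta_gt0; rewrite /betaR; case: (betaX D VX QX) => //=; rewrite ltxx.
Qed.

Lemma has_structure_ge0 u : s <> General -> VX u -> 0 <= a u u.
Proof.
case: s a_s => [|at'|at'|at'] //=.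
- by move=> [_ _ app _] _; exact: app.
- move=> [at0 acoer] _ VXu; apply: le_trans (acoer _ VXu).
  by rewrite mulr_ge0 ?sqr_ge0// ltW.
- move=> [_ at0 acoer] _ VXu; apply: le_trans (acoer _ VXu).
  by rewrite mulr_ge0 ?sqr_ge0// ltW.
Qed.

(** Here [a w w] may be negative, but [eps a w w >= - eps Ma (Ups / beta)^2 |D w|^2], which is
    absorbed into [|D w|^2] because [eps < eps0]. *)
Lemma general_energy : s = General ->
  `|D w| ^+ 2 <= eps0_ratio a D VX QX s eps * eps * '<D w, g>.
Proof.
move=> /eps0_ratioP/(_ betaX_EFin)[]; set r := eps0_ratio _ _ _ _ _ _ => rE r0.
rewrite -mulrA -response_energy.
have aM := bilinear_bound a_cont w (- w).
have w_le : eps * Ma a * `|w| ^+ 2 <= eps * Ma a * (Ups / beta * `|D w|) ^+ 2.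
  apply: ler_wpM2l; first by rewrite mulr_ge0 ?eps_ge0// bilinear_norm_ge0.
  rewrite ler_pXn2r ?nnegrE// ?mulr_ge0 ?invr_ge0 ?Upsilon_ge0 ?(ltW beta_gt0)//.
  by rewrite mulrAC ler_pdivlMr// mulrC response_Upsilon.
have aw : - (eps * Ma a * `|w| ^+ 2) <= eps * a w w.
  move: aM; rewrite normrN linearNr/= => aM.
  have := ler_wpM2l eps_ge0 aM; lra.
rewrite -[leLHS]mulr1 -rE mulrCA ler_pM2l//.
by move: w_le; rewrite exprMn mulrA; lra.
Qed.

(** * Response and residual bounds with the constants of each case *)

Lemma C2_ge0 : 0 <= C2 a D VX QX s eps.
Proof.
have e0 := eps_ge0; have M0 := bilinear_norm_ge0 a_cont; have U0 := Upsilon_ge0.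
have b2 : 0 <= beta ^+ 2 by exact: sqr_ge0.
have ratio sG := ltW (eps0_ratioP sG betaX_EFin).2.
move: a_s U0 ratio; rewrite /C2; case: s => [|at'|at'|at'] as' U0 ratio.
- by apply: mulr_ge0 (ratio erefl); rewrite divr_ge0 ?sqr_ge0.
- by rewrite divr_ge0 ?sqr_ge0.
- case: as' => at0 _; rewrite divr_ge0 ?exprn_ge0// addr_ge0//.
  by rewrite mulr_ge0 ?exprn_ge0// mulr_ge0// ltW.
- by rewrite divr_ge0 ?exprn_ge0// addr_ge0// mulr_ge0.
Qed.

Lemma C3_ge0 : 0 <= C3 a D VX QX s eps.
Proof.
have U0 := Upsilon_ge0; have M0 := linear_norm_ge0 D_bounded.
have ratio sG := ltW (eps0_ratioP sG betaX_EFin).2.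
have b0 := ltW beta_gt0.
move: U0 ratio; rewrite /C3; case: s => [|at'|at'|at'] U0 ratio.
- by apply: mulr_ge0 (ratio erefl); rewrite divr_ge0.
- by rewrite divr_ge0.
- by rewrite divr_ge0 ?sqrtr_ge0// mulr_ge0.
- by rewrite divr_ge0 ?sqrtr_ge0// mulr_ge0.
Qed.

Lemma C4_ge0 : 0 <= C4 a D VX QX s eps.
Proof.
have e0 := eps_ge0; have M0 := bilinear_norm_ge0 a_cont; have U0 := Upsilon_ge0.
have b2 : 0 <= beta ^+ 2 by exact: sqr_ge0.
have ratio sG := ltW (eps0_ratioP sG betaX_EFin).2.
move: U0 ratio; rewrite /C4; case: s => [|at'|at'|at'] U0 ratio.
- by apply: mulr_ge0 (ratio erefl); rewrite divr_ge0// mulr_ge0.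
- by rewrite divr_ge0// addr_ge0// mulr_ge0.
- apply: divr_ge0; first exact: mulr_ge0.
  by apply: addr_ge0 => //; apply: mulr_ge0 => //; exact: mulr_ge0.
- by rewrite divr_ge0// addr_ge0// mulr_ge0.
Qed.

Lemma response_C2 K : 0 <= K -> '<D w, g> <= K * `|w| ->
  `|w| <= eps * C2 a D VX QX s eps * K.
Proof.
move=> K0 gK; have e0 := eps_ge0; have en := response_energy.
have [w0|w0] := eqVneq w 0.
  by rewrite {1}w0 normr0 mulr_ge0// mulr_ge0// C2_ge0.
have b2 : 0 < beta ^+ 2 by rewrite exprn_gt0.
have L1 r r0 Dw := @response_le_energy_dual r K r0 K0 Dw gK.
have L2 c c0 Dw := @response_elliptic_dual c K c0 K0 Dw gK.
(* [Upsilon_lift] with [v := w]. In the elliptic case this passes from [Ups ^+ 2] to the [Ups ^+ 3]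
   of [C2]. *)
have U1 : 1 <= Ups.
  have := Upsilon_lift response_orthogonal VXw VXw erefl.
  by rewrite ler_pMl// normr_gt0.
have ge0 := fun sG => @has_structure_ge0 w sG VXw; have gen := general_energy.
have ratio sG := ltW (eps0_ratioP sG betaX_EFin).2.
have M0 := bilinear_norm_ge0 a_cont.
move: a_s ge0 gen L1 L2 ratio U1; rewrite /C2.
case: s => [|at'|at'|at'] as' ge0 gen L1 L2 ratio U1.
- by apply: L1 (gen erefl); exact: ratio.
- rewrite -[_ / _]mulr1; apply: L1 => //; rewrite mul1r -en lerDl mulr_ge0//.
  exact: ge0.
- case: as' => at0 /(_ _ VXw) coer.
  have e_at : 0 <= eps * at' by rewrite mulr_ge0// ltW.
  apply: le_trans (L2 (eps * at') _ _) _ => //.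
    by rewrite -en lerD2l -mulrA ler_wpM2l.
  apply: ler_wpM2r => //; apply: ler_wpM2l => //; apply: ler_wpM2r.
    by rewrite invr_ge0 addr_ge0 ?(ltW b2)// mulr_ge0// sqr_ge0.
  by rewrite [leRHS]exprS ler_peMl// sqr_ge0.
- case: as' => _ at0 /(_ _ VXw) coer.
  (* Here [Ups^2 = Ma / at'], so the denominator of [C2] has the form required with
     [c := eps * at']. *)
  rewrite (_ : eps * Ma a = eps * at' * Upsilon a D VX QX (SymElliptic at') ^+ 2);
    last first.
    rewrite /= sqr_sqrtr; last by rewrite divr_ge0// ltW.
    by field; rewrite !gt_eqF.
  apply: L2; first by rewrite mulr_ge0// ltW.
  by rewrite -en lerD2l -mulrA ler_wpM2l.
Qed.

Lemma response_C3 : `|w| <= eps * C3 a D VX QX s eps * `|g|.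
Proof.
have e0 := eps_ge0; have en := response_energy.
have L1 r r0 Dw := @response_le_energy r r0 Dw.
have L2 c c0 Dw := @response_elliptic c c0 Dw.
have ge0 := fun sG => @has_structure_ge0 w sG VXw; have gen := general_energy.
have ratio sG := ltW (eps0_ratioP sG betaX_EFin).2.
move: a_s ge0 gen L1 L2 ratio; rewrite /C3.
case: s => [|at'|at'|at'] as' ge0 gen L1 L2 ratio.
- by apply: L1 (gen erefl); exact: ratio.
- rewrite -[_ / _]mulr1; apply: L1 => //; rewrite mul1r -en lerDl mulr_ge0//.
  exact: ge0.
- case: as' => at0 /(_ _ VXw) coer; apply: L2; first by rewrite mulr_ge0// ltW.
  by rewrite -en lerD2l -mulrA ler_wpM2l.
- case: as' => _ at0 /(_ _ VXw) coer; apply: L2; first by rewrite mulr_ge0// ltW.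
  by rewrite -en lerD2l -mulrA ler_wpM2l.
Qed.

Lemma residual_C4 : `|h| <= eps * C4 a D VX QX s eps * `|g|.
Proof.
have M0 := bilinear_norm_ge0 a_cont; have U0 := Upsilon_ge0.
have L1 N N0 hN := @residual_le_energy N N0 hN.
have ge0 := fun sG u VXu => @has_structure_ge0 u sG VXu.
have ratio sG := ltW (eps0_ratioP sG betaX_EFin).2.
have gen sG := response_le_energy (ratio sG) (general_energy sG).
have hw := residual_le.
move: a_s ge0 gen L1 U0; rewrite /C4.
case: s => [|at'|at'|at'] as' ge0 gen L1 U0.
- rewrite -(ler_pM2l beta_gt0); apply: le_trans hw _.
  apply: le_trans (ler_wpM2l M0 (gen erefl)) _.
  by rewrite le_eqVlt; apply/predU1P; left; field; rewrite !gt_eqF.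
- case: as' => asym _ _ _; apply: L1 => //; apply: residual_le_sym => // u; exact: ge0.
(* [N := Ma * Ups] works, since [Ma^2 |w|^2 = Ma Ups at' |w|^2 <= Ma Ups (a w w)]. *)
- case: as' => at0 /(_ _ VXw) coer; rewrite -[eps * Ma a * _]mulrA.
  apply: L1; first by rewrite mulr_ge0.
  have : (beta * `|h|) ^+ 2 <= (Ma a * `|w|) ^+ 2.
    by rewrite ler_pXn2r ?nnegrE ?mulr_ge0// ltW.
  move=> /le_trans; apply.
  apply: le_trans (ler_wpM2l _ coer); last by rewrite mulr_ge0.
  by rewrite le_eqVlt; apply/predU1P; left; rewrite /=; field; rewrite !gt_eqF.
- case: as' => asym _ _; apply: L1 => //; apply: residual_le_sym => // u; exact: ge0.
Qed.

(** The bound with [C2] uses [K] directly; the one with [C3] uses [beta |g| <= K]. *)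
Lemma response_dual_bound K : 0 <= K -> (forall v, VX v -> '<D v, g> <= K * `|v|) ->
  `|w| <= eps * Num.min (C2 a D VX QX s eps) (beta^-1 * C3 a D VX QX s eps) * K.
Proof.
move=> K0 gK; rewrite minr_pMr ?eps_ge0// minr_pMl// le_min.
rewrite (response_C2 K0 (gK _ VXw)) /=.
apply: le_trans response_C3 _.
rewrite (_ : _ * K = eps * C3 a D VX QX s eps * (K / beta)); last by ring.
apply: ler_wpM2l; first by rewrite mulr_ge0 ?eps_ge0 ?C3_ge0.
by rewrite ler_pdivlMr// mulrC betaR_le.
Qed.

Lemma response_bound : `|w| <= eps * C23 a D VX QX s eps * `|g|.
Proof.
have M0 := linear_norm_ge0 D_bounded.
rewrite /C23 minr_pMr ?eps_ge0// minr_pMl// le_min response_C3 andbT.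
rewrite (_ : _ * `|g| = eps * C2 a D VX QX s eps * (MD D * `|g|)); last by ring.
apply: response_C2; first by rewrite mulr_ge0.
apply: le_trans (inner_le _ _) _; rewrite mulrAC; apply: ler_wpM2r => //.
exact: bounded_linear_bound.
Qed.

Lemma residual_bound : `|h| <=
  eps * Num.min (Ma a / beta * C23 a D VX QX s eps) (C4 a D VX QX s eps) * `|g|.
Proof.
rewrite minr_pMr ?eps_ge0// minr_pMl// le_min residual_C4 andbT.
rewrite (_ : _ * `|g| = Ma a * (eps * C23 a D VX QX s eps * `|g|) / beta); last by ring.
rewrite ler_pdivlMr// mulrC; apply: le_trans residual_le _.
apply: ler_wpM2l; first exact: bilinear_norm_ge0.
exact: response_bound.
Qed.

Lemma C23_ge0 : 0 <= C23 a D VX QX s eps.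
Proof. by rewrite /C23 le_min C3_ge0 mulr_ge0 ?C2_ge0// linear_norm_ge0. Qed.

Lemma tau_ge0 rho : 0 < rho -> 0 <= tau a D VX QX s lambda rho.
Proof.
move=> rho0; rewrite /tau addr_ge0 ?normr_ge0// mulr_ge0//.
  rewrite divr_ge0 ?exprn_ge0 ?(ltW lambda_gt0)// mulr_ge0 ?(ltW rho0)//.
  exact: bilinear_norm_ge0.
by rewrite le_min C2_ge0 mulr_ge0 ?C3_ge0// invr_ge0 ltW.
Qed.

Lemma xi_ge0 rho : 0 < rho -> 0 <= xi a D VX QX s lambda rho.
Proof.
move=> rho0; rewrite /xi addr_ge0 ?normr_ge0// mulr_ge0//.
  by rewrite divr_ge0 ?exprn_ge0 ?(ltW lambda_gt0)// (ltW rho0).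
by rewrite le_min C4_ge0 mulr_ge0 ?C23_ge0// divr_ge0 ?bilinear_norm_ge0// ltW.
Qed.

End Structure.
End Discretization.

(** * From one-step error bounds to the final estimates *)

(** To be applied with [e] and [d] the error norms of [u n] and [p n]. The values of [e] start at
    index 1, as [u 0] is unconstrained. *)
Lemma error_recursion (R : realDomainType) (e d : nat -> R) (eta tau xi c1 c2 : R) :
  0 <= eta -> 0 <= tau -> 0 <= xi -> 0 <= c1 -> 0 <= c2 ->
  (forall n, e n.+2 <= tau * e n.+1) ->
  (forall n, d n.+1 <= c1 * e n.+1 + eta * d n) ->
  (forall n, e n.+1 <= c2 * d n) ->
  (forall n, d n.+1 <= xi * d n) ->
  (forall n, e n.+1 <= tau ^+ n * e 1%N /\
     d n.+1 <= c1 * (\sum_(1 <= i < n.+2) eta ^+ (n.+1 - i) * tau ^+ i.-1) * e 1%N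
       + eta ^+ n.+1 * d 0%N) /\
  (forall n, e n.+1 <= c2 * xi ^+ n * d 0%N /\ d n.+1 <= xi ^+ n.+1 * d 0%N).
Proof.
move=> eta0 tau0 xi0 c10 c20 eS dS ed dxi.
have e_le n : e n.+1 <= tau ^+ n * e 1%N.
  elim: n => [|n IH]; first by rewrite expr0 mul1r.
  by apply: le_trans (eS n) _; rewrite exprS -mulrA ler_wpM2l.
have d_le n : d n <= xi ^+ n * d 0%N.
  elim: n => [|n IH]; first by rewrite expr0 mul1r.
  by apply: le_trans (dxi n) _; rewrite exprS -mulrA ler_wpM2l.
split=> n; split=> //; last first.
  by apply: le_trans (ed n) _; rewrite -mulrA ler_wpM2l.
elim: n => [|n IH].
  by apply: le_trans (dS 0%N) _; rewrite big_nat1 !expr0 expr1 !mulr1.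
apply: le_trans (dS n.+1) _.
(* Each step multiplies the old sum by [eta] and appends the newest power of [tau]. *)
have -> : \sum_(1 <= i < n.+3) eta ^+ (n.+2 - i) * tau ^+ i.-1
    = eta * (\sum_(1 <= i < n.+2) eta ^+ (n.+1 - i) * tau ^+ i.-1) + tau ^+ n.+1.
  rewrite big_nat_recr//= subnn expr0 mul1r big_distrr/=; congr (_ + _).
  apply: eq_big_nat => i /andP[_ ilt].
  by rewrite subSn// exprS mulrA.
have := ler_wpM2l c10 (e_le n.+1).
have := ler_wpM2l eta0 IH.
rewrite [eta ^+ n.+2]exprS; lra.
Qed.

Theorem theorem4p3 (R : realType) (V Q : hilbertType R)
    (a : bilinear_form R V) (D : {linear V -> Q})
    (a_cont : continuous (fun uv : V * V => a uv.1 uv.2))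
    (D_bounded : bounded_near D (nbhs (0 : V)))
    (D_surj : range D = [set: Q])
    (alpha : R) (alpha_gt0 : 0 < alpha)
    (alpha_le : (alpha%:E <= infsup (nullspace D) (nullspace D) a)%E)
    (alpha_le' :
      (alpha%:E <= infsup (nullspace D) (nullspace D) (fun v u => a u v))%E)
    (VX : set V) (QX : set Q)
    (VX_fin : finite_dim_subspace VX) (QX_fin : finite_dim_subspace QX)
    (D_VX : D @` VX = QX)
    (alphaX_gt0 : (0 < alphaX a D VX QX)%E)
    (alphaX_sym : alphaX a D VX QX
      = infsup (discrete_kernel D VX QX) (discrete_kernel D VX QX)
          (fun v u => a u v))
    (betaX_gt0 : (0 < betaX D VX QX)%E)
    (s : structure R) (a_s : has_structure a D VX QX s)
    (F : V -> R) (G : Q -> R) (F_lin : linear_on VX F) (G_lin : linear_on QX G)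
    (lambda rho : R) (rho_gt0 : 0 < rho) (lambda_gt0 : 0 < lambda)
    (lambda_gt : ((eps0 a D VX QX s)^-1 < lambda%:E)%E)
    (uX : V) (pX : Q) (uX_pX : saddle_point_solution a D VX QX F G uX pX)
    (u : nat -> V) (p : nat -> Q)
    (u_p : iterated_penalty a D VX QX F G lambda rho u p)
    (ulam : V) (ulam_sol : penalized_solution a D VX F G lambda ulam) :
  let eta := eta lambda rho in
  let tau := tau a D VX QX s lambda rho in
  let xi := xi a D VX QX s lambda rho in
  let beta := betaR D VX QX in
  let C23 := C23 a D VX QX s lambda^-1 in
  (forall n : nat, (1 <= n)%N ->
     `|uX - u n| <= tau ^+ n.-1 * `|uX - ulam|
     /\ `|pX - p n| <= rho * Ma a / (lambda * beta)
          * (\sum_(1 <= i < n.+1) eta ^+ (n - i) * tau ^+ i.-1)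
          * `|uX - ulam| + eta ^+ n * `|pX|)
  /\
  (forall n : nat, (1 <= n)%N ->
     `|uX - u n| <= lambda^-1 * C23 * xi ^+ n.-1 * `|pX|
     /\ `|pX - p n| <= xi ^+ n * `|pX|).
Proof.
move=> eta_ tau_ xi_ beta C23_.
have [VXuX QXpX uX_eq DuX_eq] := uX_pX.
have [p0 up] := u_p.
have QXD v : VX v -> QX (D v) by move=> VXv; exact: (image_QX D_VX).
have riesz_G : riesz_inv QX G = D uX.
  apply: xget_unique; first by split=> [|q]; [exact: QXD|exact: DuX_eq].
  move=> q [QXq qE]; apply: (orthogonal_eq QX_fin) => //; first exact: QXD.
  by move=> r QXr; rewrite [LHS]qE// DuX_eq.
have QXp n : QX (p n).
  by case: n => [|n]; [rewrite p0; exact: subspace0|have [] := up n.+1 isT].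
have VXu n : VX (u n.+1) by have [] := up n.+1 isT.
pose d n := pX - p n; pose w n := u n - uX.
have QXd n : QX (d n) by exact: subspaceB.
have VXw n : VX (w n.+1) by exact: subspaceB.
(* The saddle point solution is a fixed point of the iteration; subtracting gives the error equation
   [wE]. *)
have uXE v : VX v -> a uX v + lambda * '<D uX, D v> = F v + lambda * G (D v) - '<D v, pX>.
  by move=> VXv; rewrite -uX_eq// DuX_eq; [ring|exact: QXD].
have wE n v : VX v -> a (w n.+1) v + lambda * '<D (w n.+1), D v> = '<D v, d n>.
  move=> VXv; have [_ _ /(_ _ VXv) unE _] := up n.+1 isT.
  move: unE (uXE v VXv); rewrite /= linearBl linearB/= innerBl innerBr; lra.
have dS n : d n.+1 = d n - rho *: D (w n.+1).
  have [_ _ _ pE] := up n.+1 isT.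
  by rewrite /d pE riesz_G /w (linearB D) opprD addrA.
(* As [p 0 = 0], the first iterate solves the equation of [ulam], so the difference is a response to
   0. *)
have ulamE v : VX v ->
    a (u 1%N - ulam) v + lambda * '<D (u 1%N - ulam), D v> = '<D v, 0>.
  move=> VXv; have [_ _ /(_ _ VXv) u1E _] := up 1%N isT.
  have := ulam_sol.2 _ VXv; move: u1E.
  rewrite /= p0 linear0r linearBl linearB/= innerBl; lra.
have VXul : VX (u 1%N - ulam) by apply: subspaceB => //; exact: ulam_sol.1.
have [[q [QXq q0]]|QX0] := pselect (exists q, QX q /\ q != 0); last first.
  have QX_eq0 q : QX q -> q = 0.
    by move=> QXq; apply/eqP/negPn/negP => q0; apply: QX0; exists q.
  have VX_eq0 v : VX v -> (forall v', VX v' ->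
      a v v' + lambda * '<D v, D v'> = 0) -> v = 0.
    move=> VXv av; apply/eqP; rewrite -normr_le0.
    have D0 v' : VX v' -> D v' = 0 by move=> VXv'; exact/QX_eq0/QXD.
    (* The discrete kernel is now all of [VX], so [kernel_le] with [k = 0] gives uniqueness. *)
    rewrite -(mulr0 (fine ((Ma a)%:E / alphaX a D VX QX)%E)).
    apply: (kernel_le a_cont alphaX_gt0) => //.
      by apply/(discrete_kernelP D_VX); split=> //; exact: D0.
    move=> v' [VXv' _]; have := av _ VXv'.
    by rewrite (D0 v VXv) linear0l mulr0 addr0 => ->; rewrite mulr0 mul0r.
  have d0 n : d n = 0 by exact: QX_eq0.
  have w0 n : w n.+1 = 0.
    by apply: VX_eq0 => // v VXv; rewrite wE// d0 linear0r.
  have ul0 : u 1%N - ulam = 0.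
    by apply: VX_eq0 => // v VXv; rewrite ulamE// linear0r.
  have pX0 : pX = 0 by exact: QX_eq0.
  have uXul : uX - ulam = 0.
    by rewrite -(subrKA (u 1%N)) ul0 addr0 -opprB -/(w 1%N) w0 oppr0.
  split=> -[//|n] _; rewrite distrC -/(w n.+1) w0 -/(d n.+1) d0 ?uXul pX0 !normr0;
    by rewrite !mulr0 ?addr0 lexx.
have beta0 : 0 < beta by exact: (betaR_gt0 D_bounded betaX_gt0 QXq q0).
have M0 := bilinear_norm_ge0 a_cont.
pose h n := d n - lambda *: D (w n.+1).
have hE n v : VX v -> a (w n.+1) v = '<D v, h n> by exact: (residualE (wE n)).
have dh n : d n.+1 = (1 - rho / lambda) *: d n + (rho / lambda) *: h n.
  rewrite dS /h (scalerBr _ (d n)) scalerA divfK ?gt_eqF//.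
  by rewrite addrA -scalerDl subrK scale1r.
have d_le n : `|d n.+1| <= eta_ * `|d n| + rho / lambda * `|h n|.
  rewrite dh; apply: le_trans (ler_normD _ _) _.
  by rewrite (normrZ _ (d n)) (normrZ _ (h n)) (gtr0_norm (divr_gt0 rho_gt0 lambda_gt0)).
have bnd := response_bound a_cont D_bounded VX_fin QX_fin D_VX alphaX_gt0 betaX_gt0
  a_s beta0 lambda_gt0 lambda_gt.
have dual_bnd := response_dual_bound a_cont D_bounded VX_fin QX_fin D_VX alphaX_gt0
  betaX_gt0 a_s beta0 lambda_gt0 lambda_gt.
have u1E : u 1%N = ulam.
  apply/eqP; rewrite -subr_eq0 -normr_le0.
  have := bnd 0 _ VXul ulamE.
  by rewrite normr0 mulr0.
have wS n : `|w n.+2| <= tau_ * `|w n.+1|.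
  (* [t] is the response to [(rho / lambda) h n], a functional bounded through
     [<D v, h n> = a (w n.+1) v]. *)
  pose t := w n.+2 - (1 - rho / lambda) *: w n.+1.
  have VXt : VX t by rewrite /t addrC -scaleNr; exact: subspace_lincomb.
  have QXh : QX (h n) by exact: (residual_QX QX_fin D_VX).
  have t_le : `|t| <= lambda^-1 * Num.min (C2 a D VX QX s lambda^-1)
      (beta^-1 * C3 a D VX QX s lambda^-1) * (rho / lambda * (Ma a * `|w n.+1|)).
    apply: (@dual_bnd ((rho / lambda) *: h n)).
    - by rewrite -[_ *: _]addr0; apply: subspace_lincomb (subspace0 _).
    - by [].
    - move=> v VXv; rewrite /t linearBl/= linearZl_LR/=.
      rewrite (linearB D) (linearZ_LR D) innerBl innerZl.
      have := congr1 ( *%R (1 - rho / lambda)) (wE n v VXv); have := wE n.+1 v VXv.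
      rewrite dh innerDr !innerZr; generalize (rho / lambda) => r; lra.
    - by rewrite !mulr_ge0// ?invr_ge0 ltW.
    - move=> v VXv; rewrite innerZr -hE// -[leRHS]mulrA.
      by apply: ler_wpM2l; [rewrite divr_ge0// ltW|exact: bilinear_bound].
  rewrite -(subrK ((1 - rho / lambda) *: w n.+1) (w n.+2)) -/t.
  apply: le_trans (ler_normD _ _) _; rewrite normrZ mulrDl lerD2r.
  apply: le_trans t_le _; rewrite le_eqVlt; apply/predU1P; left; field.
  by rewrite !gt_eqF.
have wd n : `|w n.+1| <= lambda^-1 * C23_ * `|d n| by exact: (bnd _ _ (VXw n) (wE n)).
have dw n : `|d n.+1| <= rho * Ma a / (lambda * beta) * `|w n.+1| + eta_ * `|d n|.
  rewrite addrC; apply: le_trans (d_le n) _; rewrite lerD2l.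
  have := residual_le a_cont D_bounded QX_fin D_VX betaX_gt0 (QXd n) (VXw n) (wE n).
  move=> hw.
  rewrite (_ : _ * `|w _| = rho / lambda * (Ma a * `|w n.+1| / beta)); last first.
    by field; rewrite !gt_eqF.
  apply: ler_wpM2l; first by rewrite divr_ge0// ltW.
  by rewrite ler_pdivlMr// mulrC.
have dxi n : `|d n.+1| <= xi_ * `|d n|.
  apply: le_trans (d_le n) _; rewrite addrC mulrDl lerD2r.
  have := residual_bound a_cont D_bounded VX_fin QX_fin D_VX alphaX_gt0 betaX_gt0
    a_s beta0 lambda_gt0 lambda_gt (QXd n) (VXw n) (wE n).
  have rl0 : 0 <= rho / lambda by rewrite divr_ge0// ltW.
  move=> /(ler_wpM2l rl0) /le_trans; apply.
  by rewrite le_eqVlt; apply/predU1P; left; field; rewrite !gt_eqF.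
have := @error_recursion _ (fun n => `|w n|) (fun n => `|d n|) eta_ tau_ xi_
  (rho * Ma a / (lambda * beta)) (lambda^-1 * C23_).
case=> //.
- exact: normr_ge0.
- exact: tau_ge0.
- exact: xi_ge0.
- by rewrite divr_ge0 ?mulr_ge0// ltW.
- by rewrite mulr_ge0 ?invr_ge0 ?(ltW lambda_gt0)//; exact: C23_ge0.
have d0E : d 0%N = pX by rewrite /d p0 subr0.
have w1E : `|w 1%N| = `|uX - ulam| by rewrite /w u1E distrC.
rewrite d0E w1E => r1 r2; split=> -[//|n] _; rewrite distrC; [exact: r1|exact: r2].
Qed.
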